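(* Let $R$ be a ring which is a maximal subring of a ring $T$ with $|\mathrm{Min}(R)|\geq 3$. Then $(R:T)$ and $(R:T)_l(R:T)_r$ are nonzero.
   Context: All rings are associative, unital with $1\neq 0$, and not necessarily commutative; subrings contain the identity of the overring. A subring $R\subsetneq T$ is a maximal subring of $T$ if there is no subring $S$ with $R\subsetneq S\subsetneq T$. $(R:T):=\{x\in T\mid TxT\subseteq R\}$, $(R:T)_l:=\{x\in T\mid Tx\subseteq R\}$ and $(R:T)_r:=\{x\in T\mid xT\subseteq R\}$ are respectively the largest two-sided, left and right ideal of $T$ contained in $R$; all are two-sided ideals of $R$. $\mathrm{Min}(R)$ is the set of minimal prime ideals of $R$. *)

(* Defs.v *)
From HB Require Import structures.
From mathcomp Require Import all_boot all_algebra.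
From mathcomp Require Import boolp classical_sets functions cardinality.

Set Implicit Arguments.
Unset Strict Implicit.
Unset Printing Implicit Defensive.

Import GRing.Theory.
Local Open Scope ring_scope.
Local Open Scope classical_set_scope.

(* The type T : nzRingType is the (associative, unital, nonzero, possibly
   noncommutative) overring; subrings of T, and ideals of those subrings, are
   sets of elements of T. *)
Section Subrings.
Variable T : nzRingType.
Implicit Types R S I J P Q : set T.

Definition is_subring S : Prop := subring_closed (mem S).

Definition maximal_subring R : Prop :=
  [/\ is_subring R, R `<` [set: T] &
      ~ exists S, [/\ is_subring S, R `<` S & S `<` [set: T]]].

Definition is_ideal R I : Prop :=
  [/\ I `<=` R, zmod_closed (mem I) &
      forall r x, R r -> I x -> I (r * x) /\ I (x * r)].

Definition ideal_mul I J : set T :=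
  [set x | exists n (a b : 'I_n -> T),
     (forall i, I (a i) /\ J (b i)) /\ x = \sum_(i < n) a i * b i].

(* Primeness in the sense of noncommutative rings (products of two-sided
   ideals), not complete primeness. *)
Definition is_prime_ideal R P : Prop :=
  [/\ is_ideal R P, P `<` R &
      forall I J, is_ideal R I -> is_ideal R J ->
        ideal_mul I J `<=` P -> I `<=` P \/ J `<=` P].

Definition Min R : set (set T) :=
  [set P | is_prime_ideal R P /\
           forall Q, is_prime_ideal R Q -> Q `<=` P -> Q = P].

Definition conductor R : set T := [set x | forall s t : T, R (s * x * t)].

Definition lconductor R : set T := [set x | forall t : T, R (t * x)].

Definition rconductor R : set T := [set x | forall t : T, R (x * t)].

End Subrings.

(* Main.v *)
Require Import Defs.
From HB Require Import structures.
From mathcomp Require Import all_boot all_algebra.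
From mathcomp Require Import boolp classical_sets functions cardinality.

Set Implicit Arguments.
Unset Strict Implicit.
Unset Printing Implicit Defensive.

Import GRing.Theory.
Local Open Scope ring_scope.
Local Open Scope classical_set_scope.

(** Write [L] and [K] for the left and right conductors of [R] in [T].  The
    point is that maximality of [R] makes [L], and by symmetry [K], a prime
    ideal of [R] ([prime_lconductor], [prime_rconductor]).  Indeed, let [I]
    and [J] be ideals of [R] with [I J] contained in [L].  If [I] is not
    contained in [L], then [R + T I] is a subring strictly larger than [R],
    hence is [T], so that [T J = R J + T I J] lies in [R], that is, [J] is
    contained in [L].

    If [L K = 0], then every prime ideal of [R] contains [L] or [K], so the
    only possible minimal primes are [L] and [K], against the assumption that
    there are at least three.  Hence [L K] is nonzero, and so is the
    conductor, which contains [L K]. *)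

Section Conductors.
Variable T : nzRingType.
Implicit Types R S I J P Q : set T.

Lemma is_subringP S :
  is_subring S <->
  [/\ S 1, forall x y, S x -> S y -> S (x - y)
         & forall x y, S x -> S y -> S (x * y)].
Proof.
split=> [[S1 SB SM]|[S1 SB SM]].
  split=> [|x y Sx Sy|x y Sx Sy]; apply/set_mem;
    [exact: S1 | apply: SB; exact/mem_set | apply: SM; exact/mem_set].
split; first exact/mem_set.
  by move=> x y /set_mem Sx /set_mem Sy; apply/mem_set/SB.
by move=> x y /set_mem Sx /set_mem Sy; apply/mem_set/SM.
Qed.

Lemma zmod_closed_setP I :
  zmod_closed (mem I) <-> I 0 /\ forall x y, I x -> I y -> I (x - y).
Proof.
split=> [[I0 IB]|[I0 IB]].
  split=> [|x y Ix Iy]; apply/set_mem; first exact: I0.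
  by apply: IB; exact/mem_set.
split; first exact/mem_set.
by move=> x y /set_mem Ix /set_mem Iy; apply/mem_set/IB.
Qed.

Lemma subring0 R : is_subring R -> R 0.
Proof. by case/is_subringP=> R1 RB _; rewrite -(subrr 1); apply: RB. Qed.

(** A subring containing a maximal subring [R] but not contained in [R] is
    the whole ring. *)
Lemma maximal_subring_eqT R S : maximal_subring R -> is_subring S ->
  R `<=` S -> ~ S `<=` R -> forall t, S t.
Proof.
move=> [_ _ noS] ringS RS nSR t; apply: contrapT => nSt.
apply: noS; exists S; split=> //.
by split=> // TS; apply: nSt; apply: TS.
Qed.

Lemma ideal_mul_mem I J a b : I a -> J b -> ideal_mul I J (a * b).
Proof.
move=> Ia Jb; exists 1%N, (fun=> a), (fun=> b).
by split=> //; rewrite big_ord1.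
Qed.

Lemma is_ideal_lconductor R : is_subring R -> is_ideal R (lconductor R).
Proof.
move=> ringR; have [R1 RB RM] := (is_subringP _).1 ringR; split.
- by move=> x /(_ 1); rewrite mul1r.
- apply/zmod_closed_setP; split=> [t|x y Lx Ly t].
    by rewrite mulr0; apply: subring0.
  by rewrite mulrBr; apply: RB.
- move=> r x Rr Lx; split=> t; first by rewrite mulrA; apply: Lx.
  by rewrite mulrA; apply: RM.
Qed.

Theorem prime_lconductor R :
  maximal_subring R -> is_prime_ideal R (lconductor R).
Proof.
move=> maxR; have [ringR [_ nTR] _] := maxR.
have [R1 RB RM] := (is_subringP _).1 ringR.
have idL := is_ideal_lconductor ringR; split=> //.
  split; first by case: idL.
  by move=> /(_ 1 R1) L1; apply: nTR => t _; rewrite -(mulr1 t); apply: L1.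
move=> I J [IR _ IM] [JR _ _] IJL.
have [|nIL] := pselect (I `<=` lconductor R); [by left|right].
(* N is the largest left (R + T I)-submodule of T contained in R, and S is the
   ring of all t with t N contained in N; it contains R and T I, and using S
   instead of R + T I avoids any manipulation of finite sums. *)
pose N := [set x | R x /\ forall t i, I i -> R (t * i * x)].
pose S := [set t | forall x, N x -> N (t * x)].
have ringS : is_subring S.
  apply/is_subringP; split=> [x Nx|x y Sx Sy z Nz|x y Sx Sy z Nz].
  - by rewrite mul1r.
  - have [Rx Nx] := Sx _ Nz; have [Ry Ny] := Sy _ Nz.
    rewrite mulrBl; split=> [|t i Ii]; first exact: RB.
    by rewrite mulrBr; apply: RB; [apply: Nx | apply: Ny].
  - by rewrite -mulrA; apply: Sx; apply: Sy.
have RS : R `<=` S.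
  move=> r Rr x [Rx Nx]; split=> [|t i Ii]; first exact: RM.
  by rewrite mulrA -(mulrA t); apply: Nx; case: (IM r i Rr Ii).
have TIS t i : I i -> S (t * i).
  move=> Ii x [Rx Nx]; split=> [|t' i' Ii']; first exact: Nx.
  by rewrite !mulrA -(mulrA _ i); rewrite mulrA; apply: Nx.
have ST : forall t, S t.
  apply: (maximal_subring_eqT maxR) => // SR.
  by apply: nIL => i Ii t; apply: SR; apply: TIS.
have JN j : J j -> N j.
  move=> Jj; split=> [|t i Ii]; first exact: JR.
  by rewrite -mulrA; apply: IJL; apply: ideal_mul_mem.
by move=> j Jj t; have [] := ST t _ (JN j Jj).
Qed.

Lemma ideal_mul_conductor R : is_subring R ->
  ideal_mul (lconductor R) (rconductor R) `<=` conductor R.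
Proof.
move=> ringR x [n [a [b [ab ->]]]] s t.
have [R1 RB RM] := (is_subringP _).1 ringR.
rewrite mulr_sumr mulr_suml; apply: (big_ind R) => [|u v Ru Rv|i _].
- exact: subring0.
- by rewrite -(opprK v) -(sub0r v); apply: (RB) => //; apply: RB => //;
    apply: subring0.
- by have [La Kb] := ab i; rewrite mulrA -mulrA; apply: RM.
Qed.

Lemma ideal_mul_set0 I J : I 0 -> J 0 ->
  ideal_mul I J `<=` [set 0] -> ideal_mul I J = [set 0].
Proof.
move=> I0 J0 IJ; apply/seteqP; split=> // x ->.
by rewrite -(mulr0 0); apply: ideal_mul_mem.
Qed.

(** If two prime ideals have zero product, they are the only possible minimal
    primes. *)
Lemma Min_sub_ideal_mul0 R P Q : is_prime_ideal R P -> is_prime_ideal R Q ->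
  ideal_mul P Q = [set 0] -> Min R `<=` [set P; Q].
Proof.
move=> pP pQ PQ0 M [[[_ /zmod_closed_setP[M0 _] _] _ pM] minM].
have [[idP _ _] [idQ _ _]] := (pP, pQ).
have [PM|QM] : P `<=` M \/ Q `<=` M.
- by apply: pM => //; rewrite PQ0 => x ->.
- by left; rewrite (minM _ pP PM).
- by right; rewrite (minM _ pQ QM).
Qed.

End Conductors.

(** The converse ring exchanges left and right conductors while leaving the
    notions of subring and prime ideal unchanged. *)
Section Converse.
Variable T : nzRingType.
Implicit Types R S I J P : set T.

Lemma is_subring_converse S : is_subring S <-> @is_subring T^c S.
Proof.
split=> /is_subringP[S1 SB SM]; apply/is_subringP; split=> // x y Sx Sy;
  exact: SM.
Qed.

Lemma maximal_subring_converse R :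
  maximal_subring R -> @maximal_subring T^c R.
Proof.
move=> [ringR RT noS]; split=> //; first exact/is_subring_converse.
by move=> [S [ringS RS ST]]; apply: noS; exists S; split=> //;
  apply/is_subring_converse.
Qed.

Lemma is_ideal_converse R I : is_ideal R I <-> @is_ideal T^c R I.
Proof.
by split=> -[IR I0 IM]; split=> // r x Rr Ix; have [] := IM r x Rr Ix.
Qed.

Lemma ideal_mul_converse I J : @ideal_mul T^c I J = ideal_mul J I.
Proof.
by apply/seteqP; split=> x [n [a [b [ab ->]]]]; exists n, b, a;
  split=> // i; have [] := ab i.
Qed.

Lemma is_prime_ideal_converse R P :
  @is_prime_ideal T^c R P -> is_prime_ideal R P.
Proof.
move=> [idP PR pP]; split=> //; first exact/is_ideal_converse.
move=> I J /is_ideal_converse idI /is_ideal_converse idJ IJP.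
by apply/or_comm; apply: pP => //; rewrite ideal_mul_converse.
Qed.

Theorem prime_rconductor R :
  maximal_subring R -> is_prime_ideal R (rconductor R).
Proof.
move=> maxR; apply: is_prime_ideal_converse.
exact: (prime_lconductor (maximal_subring_converse maxR)).
Qed.

End Converse.

Lemma not_card_I3_le_set2 (U : Type) (A : set U) (a b : U) :
  A `<=` [set a; b] -> ~ (`I_3 #<= A)%card.
Proof.
move=> Aab /card_leP[f].
have I0 : `I_3 0%N by []; have I1 : `I_3 1%N by []; have I2 : `I_3 2%N by [].
pose g i (Ii : `I_3 i) := set_val (f (SigSub (mem_set Ii))).
have gab i (Ii : `I_3 i) : g i Ii = a \/ g i Ii = b.
  by apply: Aab; apply: set_valP.
have ginj i j (Ii : `I_3 i) (Ij : `I_3 j) : g i Ii = g j Ij -> i = j.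
  move=> /val_inj fij.
  by have [] := inj (mem_set Logic.I) (mem_set Logic.I) fij.
have g01 : g _ I0 <> g _ I1 by move/ginj.
have g02 : g _ I0 <> g _ I2 by move/ginj.
have g12 : g _ I1 <> g _ I2 by move/ginj.
by have [] := gab _ I0; have [] := gab _ I1; have [] := gab _ I2; congruence.
Qed.

Theorem corollary2p24 (T : nzRingType) (R : set T)
    (maxR : maximal_subring R) (minR : (`I_3 #<= Min R)%card) :
  conductor R <> [set 0] /\
  ideal_mul (lconductor R) (rconductor R) <> [set 0].
Proof.
have primeL := prime_lconductor maxR; have primeK := prime_rconductor maxR.
have LK0 : ideal_mul (lconductor R) (rconductor R) <> [set 0].
  move=> LK0; apply: not_card_I3_le_set2 minR.
  exact: (Min_sub_ideal_mul0 primeL primeK LK0).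
split=> // C0; apply: LK0.
have [ringR _ _] := maxR.
have R0 := subring0 ringR.
apply: ideal_mul_set0.
- by move=> t; rewrite mulr0.
- by move=> t; rewrite mul0r.
- by rewrite -C0; apply: ideal_mul_conductor.
Qed.
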